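(* A graph $G$ is a half-square of a convex bipartite graph (i.e., there is a convex bipartite graph $B=(V(G),W,E_B)$ with $G=B^2[V(G)]$) if and only if $G$ is an interval graph.
   Context: For a bipartite graph $B=(X,Y,E_B)$, the half-square $B^2[X]$ is the graph on $X$ where two distinct vertices are adjacent iff they have a common neighbor in $Y$. $B$ is $X$-convex if there is a linear ordering of $X$ such that for every $y\in Y$, $N(y)$ is an interval (a set of consecutive elements) of $X$; $Y$-convex is defined symmetrically. $B$ is convex if it is $X$-convex or $Y$-convex. An interval graph is an intersection graph of intervals of the real line. *)

(* Defs.v *)
From mathcomp Require Import all_boot all_order all_algebra.
From mathcomp Require Import classical_sets reals normedtype.

Set Implicit Arguments.
Unset Strict Implicit.
Unset Printing Implicit Defensive.

Record sgraph := SGraph {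
  svertex :> finType;
  sedge : rel svertex;
  sedge_sym : symmetric sedge;
  sedge_irrefl : irreflexive sedge }.

(* [badj B x y] means that the edge xy is in E_B. The two sides are separate
   types, so the bipartition is part of the data. *)
Record bigraph (X Y : finType) := BiGraph { badj : X -> Y -> bool }.

Definition bswap (X Y : finType) (B : bigraph X Y) : bigraph Y X :=
  BiGraph (fun y x => badj B x y).

Section HalfSquare.
Variables (X Y : finType) (B : bigraph X Y).

Definition half_square_rel : rel X :=
  fun u v => (u != v) && [exists y, badj B u y && badj B v y].

Lemma half_square_sym : symmetric half_square_rel.
Proof.
move=> u v; rewrite /half_square_rel eq_sym; congr (_ && _).
by apply: eq_existsb => y; rewrite andbC.
Qed.

Lemma half_square_irrefl : irreflexive half_square_rel.
Proof. by move=> u; rewrite /half_square_rel eqxx. Qed.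

Definition half_square : sgraph := SGraph half_square_sym half_square_irrefl.
End HalfSquare.

Definition linear_order (T : Type) (le : rel T) : Prop :=
  [/\ reflexive le, antisymmetric le, transitive le & total le].

(* The empty set counts as a set of consecutive elements. *)
Definition consecutive (T : Type) (le : rel T) (A : pred T) : Prop :=
  forall a b c, A a -> A c -> le a b -> le b c -> A b.

Definition X_convex (X Y : finType) (B : bigraph X Y) : Prop :=
  exists le : rel X, linear_order le /\
    forall y : Y, consecutive le (fun x => badj B x y).

Definition Y_convex (X Y : finType) (B : bigraph X Y) : Prop :=
  X_convex (bswap B).

Definition convex_bigraph (X Y : finType) (B : bigraph X Y) : Prop :=
  X_convex B \/ Y_convex B.

(* Intervals are nonempty, and may be open, closed, half-open or unbounded. *)
Definition interval_graph (R : realType) (G : sgraph) : Prop :=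
  exists I : G -> set R,
    (forall v, is_interval (I v) /\ nonempty (I v)) /\
    (forall u v, sedge u v <-> u <> v /\ nonempty (setI (I u) (I v))).

Definition half_square_of_convex (G : sgraph) : Prop :=
  exists (W : finType) (B : bigraph G W),
    convex_bigraph B /\ @sedge G =2 @sedge (half_square B).

(* Main.v *)
Require Import Defs.
From mathcomp Require Import all_boot all_order all_algebra reals.
From mathcomp Require Import boolp classical_sets normedtype.

(** Given an order on one side of [B], replace the ordered elements by their
    ranks. If [V(G)] is ordered, an edge of the half-square joining [u] and [w]
    makes every vertex between them adjacent to both, so the intervals running
    from a vertex to its last neighbour represent [G]. If [W] is ordered, each
    vertex is represented by the hull of its neighbourhood, two such hulls
    meeting exactly when the consecutive neighbourhoods do; vertices without
    neighbours get private points. Conversely, pick for each pair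
    a point [t_(u, v)], lying in both [I u] and [I v] if they meet, order the
    pairs by their points, and join [x] to [(u, v)] when [t_(u, v)] lies in
    [I x]. *)

Import Order.TTheory GRing.Theory Num.Theory.

Set Implicit Arguments.
Unset Strict Implicit.
Unset Printing Implicit Defensive.

Local Open Scope ring_scope.

(** The rank counts the elements below [x]; down-sets of a linear order are nested. *)
Lemma linear_order_rank (T : finType) (le : rel T) :
  linear_order le -> exists r : T -> nat, forall x y, le x y = (r x <= r y)%N.
Proof.
move=> [le_refl _ le_trans le_total].
exists (fun x => #|[pred z | le z x]|) => x y.
apply/idP/idP => [xy|].
  by apply: subset_leq_card; apply/fintype.subsetP => z; rewrite !inE => /le_trans; apply.
apply: contraTT => xNy; rewrite -ltnNge; apply: proper_card.
have yx : le y x by case/orP: (le_total x y) xNy => // ->.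
apply/fintype.properP; split.
  by apply/fintype.subsetP => z; rewrite !inE => /le_trans; apply.
by exists x; rewrite !inE.
Qed.

(** Several pairs may receive the same point, so ties are broken to obtain antisymmetry. *)
Lemma linear_order_tiebreak (R : realType) (T : finType) (f : T -> R) :
  exists2 le : rel T, linear_order le & forall x y, le x y -> f x <= f y.
Proof.
exists (fun x y => (f x < f y) ||
    ((f x == f y) && (enum_rank x <= enum_rank y)%N)); last first.
  by move=> x y /orP[/ltW//|/andP[/eqP-> _]].
split=> [x|x y|y x z|x y].
- by rewrite eqxx leqnn orbT.
- case: ltgtP => //= _ /andP[xy yx].
  by apply/enum_rank_inj/val_inj/eqP; rewrite eqn_leq xy.
- move=> /orP[xy|/andP[/eqP-> xy]] /orP[yz|/andP[/eqP<- yz]].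
  + by rewrite (lt_trans xy yz).
  + by rewrite xy.
  + by rewrite yz.
  + by rewrite eqxx (leq_trans xy yz) orbT.
- by case: ltgtP => //= _; exact: leq_total.
Qed.

Lemma half_squareP (X Y : finType) (B : bigraph X Y) (u v : X) :
  reflect (u <> v /\ exists y, badj B u y /\ badj B v y) (half_square_rel B u v).
Proof.
apply: (iffP andP) => [[/eqP uv /existsP[y /andP[uy vy]]]|[uv [y [uy vy]]]].
  by split=> //; exists y.
by split; [exact/eqP|apply/existsP; exists y; rewrite uy].
Qed.

Lemma X_convex_interval_graph (R : realType) (X Y : finType) (B : bigraph X Y) :
  X_convex B -> interval_graph R (half_square B).
Proof.
move=> [le [le_lin conv]].
have [r leE] := linear_order_rank le_lin; case: le_lin => _ le_anti _ le_total.
(* The option [w = v] keeps [I v] nonempty when no neighbour comes after [v]. *)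
pose I (v : X) : set R := [set t | (r v)%:R <= t /\
  exists2 w, w = v \/ half_square_rel B v w & t <= (r w)%:R]%classic.
have rank_mem v : I v (r v)%:R by split=> //; exists v; first left.
have meetP u v : le u v -> u <> v ->
    half_square_rel B u v <-> (I u `&` I v !=set0)%classic.
  move=> uv uNv; split=> [euv|[t [[_ [w uw tw]] [vt _]]]].
    exists (r v)%:R; split; last exact: rank_mem.
    by split; [rewrite ler_nat -leE|exists v; first right].
  (* Through [t], [v] lies between [u] and [w]; convexity then joins [v] to a common neighbour of
     [u] and [w]. *)
  have vw : le v w by rewrite leE -(ler_nat R) (le_trans vt).
  case: uw vw {tw} => [-> vu|/half_squareP[_ [y [uy wy]]] vw].
    by case: uNv; apply: le_anti; rewrite uv.
  by apply/half_squareP; split=> //; exists y; split=> //; apply: conv uy wy uv vw.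
exists I; split=> [v|u v].
  split; last by exists (r v)%:R.
  move=> s t [vs _] [_ [w vw tw]] z /andP[sz zt].
  by split; [exact: le_trans sz|exists w => //; exact: le_trans tw].
change (half_square_rel B u v <-> u <> v /\ (I u `&` I v !=set0)%classic).
have [->|/eqP uNv] := eqVneq u v.
  by rewrite half_square_irrefl; split=> // -[].
suff -> : half_square_rel B u v <-> (I u `&` I v !=set0)%classic.
  by split=> [|[]].
case/orP: (le_total u v) => [uv|vu]; first exact: meetP.
by rewrite half_square_sym setIC; apply: meetP => // /esym.
Qed.

Lemma Y_convex_interval_graph (R : realType) (X Y : finType) (B : bigraph X Y) :
  Y_convex B -> interval_graph R (half_square B).
Proof.
move=> [le [le_lin conv]]; have [r leE] := linear_order_rank le_lin.
have [_ _ _ le_total] := le_lin.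
(* Ranks are nonnegative, so negative points are free for isolated vertices. *)
pose pt (x : X) : R := - (enum_rank x).+1%:R.
(* Quantifying over both ends avoids minima and maxima and makes the hull empty when [x] is isolated
   in [B]. *)
pose hull (x : X) : set R := [set t | exists y z,
  [/\ badj B x y, badj B x z, (r y)%:R <= t & t <= (r z)%:R]]%classic.
pose I (x : X) : set R :=
  [set t | hull x t \/ (forall y, ~~ badj B x y) /\ t = pt x]%classic.
have rank_mem x y : badj B x y -> I x (r y)%:R by left; exists y, y.
have pt_inj : injective pt.
  move=> u v /oppr_inj/eqP; rewrite eqr_nat eqSS => /eqP.
  by move/val_inj/enum_rank_inj.
have pt_hull u v : ~ hull v (pt u).
  move=> [y [z [_ _ + _]]]; rewrite leNgt => /negP; apply.
  by rewrite (@lt_le_trans _ _ 0)// oppr_lt0 ltr0n.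
exists I; split=> [x|u v].
  split; last first.
    have [[y xy]|none] := pselect (exists y, badj B x y).
      by exists (r y)%:R; exact: rank_mem.
    by exists (pt x); right; split=> // y; apply/negP => xy; apply: none; exists y.
  move=> s t [[y1 [z1 [xy1 xz1 y1s sz1]]]|[none ->]]
             [[y2 [z2 [xy2 xz2 y2t tz2]]]|[none' ->]] z /andP[sz zt].
  - by left; exists y1, z2; split=> //; [exact: le_trans sz|exact: le_trans tz2].
  - by move: xy1; rewrite (negPf (none' _)).
  - by move: xy2; rewrite (negPf (none _)).
  - by right; split=> //; apply/le_anti; rewrite zt.
split=> [/half_squareP[uNv [y [uy vy]]]|[uNv [t [ut vt]]]].
  by split=> //; exists (r y)%:R; split; exact: rank_mem.
apply/half_squareP; split=> //.
case: ut vt => [[y1 [z1 [uy1 uz1 y1t tz1]]]|[noneu ->]]; last first.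
  by case=> [/pt_hull//|[_ /pt_inj]].
case=> [[y2 [z2 [vy2 vz2 y2t tz2]]]|[_ tE]]; last first.
  by case: (@pt_hull v u); rewrite -tE; exists y1, z1.
(* The later of [y1] and [y2] is a common neighbour: its rank is at most [t], hence at most those of
   [z1] and [z2]. *)
case/orP: (le_total y1 y2) => le12.
  exists y2; split=> //; apply: (conv u) uy1 uz1 le12 _.
  by rewrite leE -(ler_nat R) (le_trans y2t).
exists y1; split=> //; apply: (conv v) vy2 vz2 le12 _.
by rewrite leE -(ler_nat R) (le_trans y1t).
Qed.

Lemma interval_graph_half_square (R : realType) (G : sgraph) :
  interval_graph R G -> half_square_of_convex G.
Proof.
move=> [I [itv edgeP]].
(* The default 0 for disjoint intervals is harmless: vertices joined to the same [w] share the point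
   [t w], whatever its value. *)
pose t (w : G * G) : R := xget 0 (I w.1 `&` I w.2)%classic.
pose B : bigraph G (G * G)%type := BiGraph (fun x w => `[< I x (t w) >]).
exists (G * G)%type, B; split.
  right; have [le le_lin le_t] := linear_order_tiebreak t.
  exists le; split=> // x a b c /asboolP xa /asboolP xc /le_t ab /le_t bc.
  by apply/asboolP; apply: (itv x).1 xa xc _ _; rewrite ab.
move=> u v; apply/idP/half_squareP =>
    [/edgeP[uNv [s Is]]|[uNv [w [/asboolP uw /asboolP vw]]]].
  split=> //; exists (u, v).
  have [? ?] : (I u `&` I v)%classic (t (u, v)) by apply: xgetPex; exists s.
  by split; apply/asboolP.
by apply/edgeP; split=> //; exists (t w).
Qed.

(** A half-square representation only gives pointwise equality of edge relations, not equality of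
    graphs. *)
Lemma interval_graph_eq (R : realType) (G : sgraph) (e : rel G)
    (e_sym : symmetric e) (e_irrefl : irreflexive e) :
  @sedge G =2 e -> interval_graph R (SGraph e_sym e_irrefl) -> interval_graph R G.
Proof.
by move=> eE [I [itv edgeP]]; exists I; split=> // u v; rewrite eE; exact: edgeP.
Qed.

Theorem theorem5 (R : realType) (G : sgraph) :
  half_square_of_convex G <-> interval_graph R G.
Proof.
split=> [[W [B [conv GE]]]|]; last exact: interval_graph_half_square.
apply: (interval_graph_eq (e_sym := half_square_sym B)
  (e_irrefl := half_square_irrefl B) GE).
case: conv; [exact: X_convex_interval_graph|exact: Y_convex_interval_graph].
Qed.
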